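(* Let $k\in\{3,4\}$ and let $n\geq 2k+1$ be an integer. Then the toughness of the Kneser graph $K(n,k)$ equals $$t(K(n,k))=\frac{n}{k}-1.$$ Moreover, any subset of vertices $S$ satisfying $t(K(n,k))=\frac{|S|}{c(K(n,k)\setminus S)}$ must be the complement of a maximum independent set in $K(n,k)$.
   Context: For integers $n\geq 2k+1$, $k\ge 1$, the Kneser graph $K(n,k)$ has as vertices the $k$-element subsets of $[n]=\{1,\dots,n\}$, two vertices $A,B$ being adjacent iff $A\cap B=\emptyset$. For a connected graph $G$, a vertex cut is a set $S$ of vertices whose removal disconnects $G$; $c(G\setminus S)$ denotes the number of connected components of the graph obtained by deleting $S$. The toughness of $G$ is $t(G)=\min_S \frac{|S|}{c(G\setminus S)}$, the minimum over all vertex cuts $S$ of $G$.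
   Formalization: In the ''moreover'' part, S is required to be a vertex cut (its removal leaves at least two components); for arbitrary subsets the claim fails, e.g. any two vertices of K(9,3) leave one component and give ratio 2 = 9/3 − 1. *)

(* Defs.v *)
From mathcomp Require Import all_boot all_order all_algebra.
Set Implicit Arguments. Unset Strict Implicit. Unset Printing Implicit Defensive.
Import Order.TTheory GRing.Theory Num.Theory.

(* A simple graph is a finite type of vertices T with a symmetric
   irreflexive adjacency relation e. *)
Section Graphs.
Variables (T : finType) (e : rel T).

Definition del_rel (S : {set T}) : rel T :=
  fun x y => [&& e x y, x \notin S & y \notin S].

Definition comp_of (S : {set T}) (x : T) : {set T} :=
  [set y | connect (del_rel S) x y].

Definition ncomp (S : {set T}) : nat :=
  #|[set comp_of S x | x in ~: S]|.

Definition vertex_cut (S : {set T}) : bool := 1 < ncomp S.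

Definition cut_ratio (S : {set T}) : rat := (#|S|%:R / (ncomp S)%:R)%R.

Definition is_toughness (t : rat) : Prop :=
  (exists2 S, vertex_cut S & cut_ratio S = t) /\
  (forall S, vertex_cut S -> (t <= cut_ratio S)%R).

Definition independent (I : {set T}) : bool :=
  [forall x in I, forall y in I, ~~ e x y].

Definition max_independent (I : {set T}) : Prop :=
  independent I /\ forall J : {set T}, independent J -> #|J| <= #|I|.
End Graphs.

Definition kneser_vertex (n k : nat) := {A : {set 'I_n} | #|A| == k}.

Definition kneser_rel (n k : nat) : rel (kneser_vertex n k) :=
  fun A B => [disjoint val A & val B].

(* Main.v *)
Require Import Defs.
From mathcomp Require Import all_boot all_order all_algebra.
From mathcomp Require Import zify ring lra.
Set Implicit Arguments. Unset Strict Implicit. Unset Printing Implicit Defensive.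
Import Order.TTheory GRing.Theory Num.Theory.

(* Write [d] for the degree, [-l] for the least eigenvalue, [u] for the second
   largest one, [N] for the number of vertices and [q = n / k]; then
   [d + l = q * l].  Let a component [H] of the graph minus [S] have [h] vertices
   and [E] ordered adjacent pairs.  Testing the Hoffman inequality
   [A + l I >= ((d + l) / N) J] on the function equal to [h / (E + l h)] on each
   component, and to 0 on [S], yields [sum_H q l h^2 / (E + l h) <= N].
   A singleton contributes exactly [q = h + q - 1] to this sum, and a component
   with [h >= 2] contributes more than [h + q - 1], i.e.
   [(h + q - 1) E < (h - 1) d h]: if [h] is small because [E <= h (h - 1)], and
   otherwise because the bound by [u] forces many edges out of [H], since [H]
   misses the closed neighbourhood of a vertex of another component.
   Hence [|V \ S| + (q - 1) c <= N], that is [(q - 1) c <= |S|], with equality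
   only if all components are singletons, i.e. if [V \ S] is independent, of the
   maximum size [N / q].  Stars attain this bound. *)

(** * Orthogonal projection *)

Section Projection.
Local Open Scope ring_scope.

(** A vector [w] in the row space of [M] with [w *m M^T = 0] is orthogonal to itself, hence zero
    over an ordered field. So [M *m M^T] has the rank of [M^T], and the obvious inclusion of row
    spaces is an equality. *)
Lemma submx_tr_gram (R : realFieldType) m p (M : 'M[R]_(m, p)) :
  (M^T <= M *m M^T)%MS.
Proof.
have sub : (M *m M^T <= M^T)%MS by apply: submxMl.
rewrite -(mxrank_leqif_sup sub) mxrank_tr -(mxrank_mul_ker M M^T).
suff -> : (M :&: kermx M^T)%MS = 0 by rewrite mxrank0 addn0.
apply/eqP/rowV0P => w; rewrite sub_capmx => /andP [/submxP [u Du] /sub_kermxP w0].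
have : (w *m w^T) 0 0 = 0 by rewrite {2}Du trmx_mul mulmxA w0 mul0mx mxE.
rewrite mxE => /eqP; rewrite psumr_eq0 => [/allP w0'|i _]; last first.
  by rewrite !mxE -expr2 sqr_ge0.
apply/rowP => i; have := w0' i (mem_index_enum i).
by rewrite !mxE -expr2 sqrf_eq0 => /eqP.
Qed.

(** The [c j] solve the normal equations of the least squares problem; [submx_tr_gram] makes these
    solvable even for a linearly dependent family [G]. *)
Lemma orthogonal_projection (R : realFieldType) (I T : finType)
    (G : I -> T -> R) (x : T -> R) :
  exists c : I -> R,
    forall i, \sum_t (x t - \sum_j c j * G j t) * G i t = 0.
Proof.
pose M := \matrix_(i < #|I|, t < #|T|) G (enum_val i) (enum_val t).
pose v := \row_(t < #|T|) x (enum_val t).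
have /submxP [D eqD] : (v *m M^T <= M *m M^T)%MS.
  by apply: submx_trans (submx_tr_gram M); apply: submxMl.
exists (fun j => D 0 (enum_rank j)) => i.
have /matrixP /(_ 0 (enum_rank i)) : (v - D *m M) *m M^T = 0.
  by rewrite mulmxBl eqD mulmxA subrr.
rewrite !mxE => E; rewrite -[RHS]E (reindex (@enum_val T T)) /=; last first.
  exact/onW_bij/enum_val_bij.
apply: eq_bigr => t _; rewrite !mxE enum_rankK; congr ((_ - _) * _).
rewrite (reindex (@enum_val I I)) /=; last exact/onW_bij/enum_val_bij.
by apply: eq_bigr => j _; rewrite !mxE enum_valK.
Qed.

End Projection.

(** Expand the product over all [i] of [a i + 1], where [a] is -1 on [X] and 0 elsewhere. This is
    the source of inclusion-exclusion below. *)
Lemma sum_sign_subset (R : comNzRingType) (I : finType) (X : {set I}) :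
  (\sum_(J : {set I} | J \subset X) (-1) ^+ #|J| = (X == set0)%:R :> R)%R.
Proof.
have := bigA_distr 1%R +%R (fun i => if i \in X then -1 else 0)%R (fun=> 1%R : R).
have -> : (\prod_i ((if i \in X then -1 else 0) + 1) = (X == set0)%:R :> R)%R.
  have [->|[i iX]] := set_0Vmem X.
    by rewrite eqxx big1 // => i _; rewrite inE add0r.
  have /negPf -> : X != set0 by apply/set0Pn; exists i.
  by rewrite (bigD1 i) //= iX addNr mul0r.
move=> ->; rewrite [LHS]big_mkcond; apply: eq_bigr => J _.
case: ifPn => [/subsetP JX|/subsetPn [i iJ iX]]; last first.
  by rewrite (bigD1 i) //= iJ (negPf iX) mul0r.
rewrite -prodr_const big_mkcond; apply: eq_bigr => i _.
by case: ifP => // /JX ->.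
Qed.

(** * Spectrum of the Kneser graph *)

Definition dot (T : finType) (x y : T -> rat) : rat := (\sum_t x t * y t)%R.

Definition adjop (T : finType) (e : rel T) (x : T -> rat) : T -> rat :=
  fun t => (\sum_(u | e t u) x u)%R.

Section Dot.
Local Open Scope ring_scope.
Variables (T : finType) (e : rel T).
Hypothesis e_sym : symmetric e.
Implicit Types x y z : T -> rat.

Lemma dotC x y : dot x y = dot y x.
Proof. by apply: eq_bigr => t _; rewrite mulrC. Qed.

Lemma dot_ge0 x : 0 <= dot x x.
Proof. by apply: sumr_ge0 => t _; rewrite -expr2 sqr_ge0. Qed.

Lemma dotDr x y z : dot x (fun t => y t + z t) = dot x y + dot x z.
Proof. by rewrite -big_split; apply: eq_bigr => t _; rewrite mulrDr. Qed.

Lemma dotDl x y z : dot (fun t => y t + z t) x = dot y x + dot z x.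
Proof. by rewrite dotC dotDr !(dotC x). Qed.

Lemma dot_sumr (I : finType) (P : pred I) (c : I -> rat) (g : I -> T -> rat) x :
  dot x (fun t => \sum_(i | P i) c i * g i t) = \sum_(i | P i) c i * dot x (g i).
Proof.
rewrite /dot; under eq_bigr do rewrite big_distrr /=.
rewrite exchange_big; apply: eq_bigr => i _; rewrite big_distrr /=.
by apply: eq_bigr => t _; rewrite mulrCA.
Qed.

Lemma dot_eq x x' y y' : x =1 x' -> y =1 y' -> dot x y = dot x' y'.
Proof. by move=> ex ey; apply: eq_bigr => t _; rewrite ex ey. Qed.

Lemma adjopD x y t : adjop e (fun t => x t + y t) t = adjop e x t + adjop e y t.
Proof. by rewrite /adjop big_split. Qed.

Lemma adjop_eq x x' : x =1 x' -> adjop e x =1 adjop e x'.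
Proof. by move=> ex t; apply: eq_bigr => u _; rewrite ex. Qed.

Lemma adjop_sum (I : finType) (P : pred I) (c : I -> rat) (g : I -> T -> rat) t :
  adjop e (fun t => \sum_(i | P i) c i * g i t) t =
  \sum_(i | P i) c i * adjop e (g i) t.
Proof.
by rewrite /adjop exchange_big; apply: eq_bigr => i _; rewrite big_distrr.
Qed.

Lemma adjop_sym x y : dot x (adjop e y) = dot (adjop e x) y.
Proof.
rewrite /dot /adjop; under eq_bigr do rewrite big_distrr big_mkcond.
under [RHS]eq_bigr do rewrite big_distrl big_mkcond.
rewrite exchange_big; apply: eq_bigr => t _; apply: eq_bigr => u _.
by rewrite e_sym.
Qed.

End Dot.

Lemma kneser_rel_sym n k : symmetric (@kneser_rel n k).
Proof. by move=> A B; rewrite /kneser_rel disjoint_sym. Qed.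

(** Removing [X] from [B] is a bijection onto the subsets of [~: (X :|: Y)] of size [k - #|X|]. *)
Lemma card_between (T : finType) (X Y : {set T}) k :
  [disjoint X & Y] -> #|X| <= k ->
  #|[set B : {set T} | [&& X \subset B, [disjoint Y & B] & #|B| == k]]| =
  'C(#|T| - #|X| - #|Y|, k - #|X|).
Proof.
move=> dXY leXk.
have <- : #|~: (X :|: Y)| = #|T| - #|X| - #|Y|.
  have dI : #|X :&: Y| = 0 by apply/eqP; rewrite cards_eq0 setI_eq0.
  by have := cardsC (X :|: Y); rewrite cardsU dI; lia.
rewrite -cards_draws -[RHS](card_in_imset (f := fun C => X :|: C)); last first.
  move=> C D; rewrite !inE setCU => /andP [sC _] /andP [sD _] /setP E.
  apply/setP => a; have := E a; rewrite !inE.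
  move/subsetP/(_ a): sC; move/subsetP/(_ a): sD; rewrite !inE.
  by case: (a \in X) => //= hD hC _; case: (a \in C) hC => [/(_ isT)//|_];
    case: (a \in D) hD => [/(_ isT)|].
apply: eq_card => B; rewrite inE; apply/idP/imsetP => [|[C]].
  move=> /and3P [sXB dYB /eqP cB]; exists (B :\: X); last first.
    by rewrite setDE setUIr setUCr setIT; apply/esym/setUidPr.
  rewrite inE cardsD (setIidPr sXB) cB eqxx andbT setCU setDE setIC.
  by rewrite setIS // -disjoints_subset disjoint_sym.
rewrite inE => /andP [sC /eqP cC] ->; rewrite subsetUl /=.
move: sC; rewrite setCU subsetI => /andP [sCX sCY].
rewrite cardsU cC.
have -> : X :&: C = set0.
  by apply/eqP; rewrite setI_eq0 disjoints_subset -setCS setCK.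
rewrite cards0 subn0 subnKC // eqxx andbT disjoint_sym disjoints_subset.
by rewrite subUset sCY andbT -disjoints_subset.
Qed.

Lemma card_kneser_vertex_set n k (P : pred {set 'I_n}) :
  #|[set A : kneser_vertex n k | P (val A)]| =
  #|[set A : {set 'I_n} | P A && (#|A| == k)]|.
Proof.
rewrite -(card_imset _ val_inj); apply: eq_card => A; rewrite inE.
apply/imsetP/idP => [[B]|/andP [PA kA]].
  by rewrite inE => PB ->; rewrite PB (valP B).
by exists (exist _ A kA); rewrite ?inE.
Qed.

Section KneserSpectrum.
Local Open Scope ring_scope.
Variables n k : nat.
Let V := kneser_vertex n k.
Let K := adjop (@kneser_rel n k).
Implicit Types (x y z : V -> rat) (U W : {set 'I_n}).

(** A monomial of degree [#|U|] in the membership indicators. Filtering by degree takes the place of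
    explicit eigenspaces. *)
Definition incl U : V -> rat := fun A => (U \subset val A)%:R.

Lemma incl0 A : incl set0 A = 1.
Proof. by rewrite /incl sub0set. Qed.

Lemma dot1r x : dot x (fun=> 1) = \sum_A x A.
Proof. by apply: eq_bigr => A _; rewrite mulr1. Qed.

(** The left side counts the [k]-sets containing [U] and disjoint from [A]: none if [U] meets [A], a
    fixed binomial otherwise. The alternating sum is the indicator that [U] and [A] are disjoint. *)
Lemma adjop_incl U A : (#|U| <= k)%N ->
  K (incl U) A = 'C(n - #|U| - k, k - #|U|)%:R *
    \sum_(W : {set 'I_n} | W \subset U) (-1) ^+ #|W| * incl W A.
Proof.
move=> leUk.
have -> : \sum_(W : {set 'I_n} | W \subset U) (-1) ^+ #|W| * incl W A
    = [disjoint U & val A]%:R.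
  rewrite -setI_eq0 -sum_sign_subset [RHS]big_mkcond [LHS]big_mkcond.
  apply: eq_bigr => W _; rewrite subsetI /incl.
  by case: (W \subset U) => //=; case: ifP; rewrite ?mulr1 ?mulr0.
have -> : K (incl U) A = #|[set B : V | [disjoint val A & val B] &&
                                        (U \subset val B)]|%:R.
  rewrite -sum1dep_card big_mkcondr natr_sum /K /adjop /incl.
  by apply: eq_bigr => B _; case: ifP.
rewrite (card_kneser_vertex_set k (fun B => [disjoint val A & B] && (U \subset B))).
rewrite -natrM; apply: (congr1 (fun m => m%:R)).
have [dUA|nUA] := boolP [disjoint U & val A].
  have := card_between dUA leUk; rewrite card_ord (eqP (valP A)) muln1 => <-.
  by apply: eq_card => B; rewrite !inE andbCA !andbA.
rewrite muln0; apply/eqP; rewrite cards_eq0 -subset0.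
apply/subsetP => B; rewrite !inE => /andP [/andP [dAB sUB] _].
by case/negP: nUA; rewrite disjoint_sym (disjointWr sUB).
Qed.

(* Inclusion-exclusion makes K triangular for the filtration by the span of
   [incl U], [#|U| <= j]: off lower-order terms it acts on level j as the
   scalar [theta j]. *)
Definition theta j : rat := (-1) ^+ j * 'C(n - j - k, k - j)%:R.

(** Against such a [z] only the term [W = U] of the expansion survives; if [#|U| < j], both sides
    vanish. *)
Lemma dot_adjop_incl z U j : (#|U| <= j)%N -> (j <= k)%N ->
  (forall W, (#|W| < j)%N -> dot z (incl W) = 0) ->
  dot z (K (incl U)) = theta j * dot z (incl U).
Proof.
move=> leUj lejk z0.
transitivity ('C(n - #|U| - k, k - #|U|)%:R *
    \sum_(W : {set 'I_n} | W \subset U) (-1) ^+ #|W| * dot z (incl W)).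
  rewrite -dot_sumr [RHS]big_distrr; apply: eq_bigr => A _.
  by rewrite adjop_incl ?(leq_trans leUj) // mulrCA.
rewrite (bigD1 U) //= big1 => [|W /andP [sWU neWU]]; last first.
  rewrite z0 ?mulr0 // (leq_trans _ leUj) // proper_card //.
  by rewrite properEneq neWU.
rewrite addr0; move: leUj; rewrite leq_eqVlt => /orP [/eqP <-|ltUj].
  by rewrite /theta; ring.
by rewrite z0 // !mulr0.
Qed.

(** Induction on the level replaces diagonalization: [x] splits into its projection [y] on the lower
    levels and an orthogonal part [z], on which the form is exactly [theta j.+1]. Cross terms
    vanish, and at level 0 the zero sum leaves only [x = 0]. *)
Lemma kneser_form_bounds_level (l u : rat) j x (c : {set 'I_n} -> rat) :
  (forall i, (0 < i <= k)%N -> l <= theta i <= u) -> (j <= k)%N ->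
  (forall A, x A = \sum_(U : {set 'I_n} | (#|U| <= j)%N) c U * incl U A) ->
  \sum_A x A = 0 ->
  l * dot x x <= dot x (K x) <= u * dot x x.
Proof.
move=> bd; elim: j x c => [|j IHj] x c lejk xE s0.
  have xc A : x A = c set0.
    rewrite xE (big_pred1 set0) => [|U]; first by rewrite incl0 mulr1.
    by rewrite leqn0 cards_eq0.
  have x0 A : x A = 0.
    move/eqP: s0; under eq_bigr do rewrite xc.
    rewrite sumr_const mulrn_eq0 => /orP [/eqP V0|/eqP c0]; last by rewrite xc.
    by case: (fintype0 A V0).
  have E y : dot x y = 0 by apply: big1 => A _; rewrite x0 mul0r.
  by rewrite !E !mulr0 lexx.
(* Padding the family with 0 above level [j] lets it be indexed by all sets. *)
have [c' z0'] := orthogonal_projection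
  (fun U A => if (#|U| <= j)%N then incl U A else 0) x.
pose y A := \sum_(U : {set 'I_n} | (#|U| <= j)%N) c' U * incl U A.
pose z A := x A - y A.
have yE A : \sum_U c' U * (if (#|U| <= j)%N then incl U A else 0) = y A.
  rewrite /y [RHS]big_mkcond; apply: eq_bigr => U _.
  by case: ifP; rewrite ?mulr0.
have z0 W : (#|W| <= j)%N -> dot z (incl W) = 0.
  move=> leWj; rewrite -[RHS](z0' W) leWj.
  by apply: eq_bigr => A _; rewrite yE.
have xyz A : x A = y A + z A by rewrite addrC subrK.
have sz : \sum_A z A = 0.
  rewrite -[RHS](z0 set0) ?cards0 // -dot1r; apply: dot_eq => // A.
  by rewrite incl0.
have sy : \sum_A y A = 0.
  by rewrite -[RHS]s0 (eq_bigr _ (fun A _ => xyz A)) big_split /= sz addr0.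
have zy : dot z y = 0 by rewrite dot_sumr big1 // => W /z0 ->; rewrite mulr0.
(* [K] preserves the span of level [j], to which [z] is orthogonal. *)
have zKy : dot z (K y) = 0.
  rewrite (dot_eq (fun=> erefl) (adjop_sum _ _ _ _)) dot_sumr big1 // => W leWj.
  rewrite (dot_adjop_incl leWj (ltnW lejk)) ?z0 ?mulr0 // => W' ltW'.
  exact/z0/ltnW.
have zc A : z A = \sum_(U : {set 'I_n} | (#|U| <= j.+1)%N)
    (c U - (if (#|U| <= j)%N then c' U else 0)) * incl U A.
  under eq_bigr do rewrite mulrBl.
  rewrite sumrB -xE /z /y; congr (_ - _).
  rewrite [LHS]big_mkcond [RHS]big_mkcond; apply: eq_bigr => U _.
  case: (leqP #|U| j) => [/leqW -> //|_].
  by rewrite mul0r; case: ifP.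
have zKz : dot z (K z) = theta j.+1 * dot z z.
  rewrite (dot_eq (fun=> erefl) (adjop_eq _ zc)).
  rewrite (dot_eq (fun=> erefl) (adjop_sum _ _ _ _)) dot_sumr.
  rewrite (dot_eq (x := z) (fun=> erefl) zc) dot_sumr big_distrr /=.
  apply: eq_bigr => U leU; by rewrite (dot_adjop_incl leU lejk z0) mulrCA.
have /andP [ly yu] := IHj y c' (ltnW lejk) (fun=> erefl) sy.
have /andP [lz zu] := bd j.+1 lejk.
clearbody z y.
have zz := dot_ge0 z.
have -> : dot x x = dot y y + dot z z.
  by rewrite (dot_eq xyz xyz) dotDr !dotDl zy dotC zy addr0 add0r.
have -> : dot x (K x) = dot y (K y) + theta j.+1 * dot z z.
  rewrite (dot_eq xyz (adjop_eq _ xyz)) (dot_eq (fun=> erefl) (adjopD _ _ _)).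
  have yKz : dot y (K z) = 0.
    exact: etrans (adjop_sym (@kneser_rel_sym n k) y z) (etrans (dotC _ _) zKy).
  by rewrite dotDr !dotDl zKy zKz yKz addr0 add0r.
by rewrite !mulrDr !lerD ?ler_wpM2r.
Qed.

End KneserSpectrum.

(** * Components and the ratio bound *)

Lemma mem_comp_of (T : finType) (e : rel T) (S : {set T}) x : x \in comp_of e S x.
Proof. by rewrite inE connect0. Qed.

Section Components.
Variables (T : finType) (e : rel T) (S : {set T}).
Hypothesis e_sym : symmetric e.

Lemma del_rel_sym : symmetric (del_rel e S).
Proof. by move=> x y; rewrite /del_rel e_sym; congr andb; rewrite andbC. Qed.

Lemma comp_of_notin x y : x \notin S -> y \in comp_of e S x -> y \notin S.
Proof.
move=> xS; rewrite inE => /connectP [p].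
by elim: p x xS => [x xS _ ->|z p IHp x _ /= /andP [/and3P [_ _ zS] /IHp]] //; apply.
Qed.

Lemma comp_of_eq x y : y \in comp_of e S x -> comp_of e S y = comp_of e S x.
Proof.
rewrite inE => cxy; apply/setP => z; rewrite !inE.
by rewrite (same_connect (sym_connect_sym del_rel_sym) cxy).
Qed.

Definition comps : {set {set T}} := [set comp_of e S x | x in ~: S].

Lemma comps_partition : partition comps (~: S).
Proof.
apply/and3P; split.
- rewrite eqEsubset; apply/andP; split; last first.
    apply/subsetP => x xS; apply/bigcupP; exists (comp_of e S x).
      exact: imset_f.
    exact: mem_comp_of.
  apply/bigcupsP => H /imsetP [x]; rewrite inE => xS ->.
  by apply/subsetP => y /(comp_of_notin xS); rewrite inE.
- apply/trivIsetP => H1 H2 /imsetP [x _ ->] /imsetP [y _ ->]; apply: contraR.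
  by case/pred0Pn => z /= /andP [/comp_of_eq <- /comp_of_eq <-].
- by apply/imsetP => -[x _ /setP /(_ x)]; rewrite mem_comp_of inE.
Qed.

Lemma comps_closed H x y :
  H \in comps -> x \in H -> y \in ~: S -> e x y -> y \in H.
Proof.
move=> /imsetP [z]; rewrite !inE => zS -> xH yS exy.
have xS := comp_of_notin zS xH; rewrite inE.
move: xH; rewrite inE => /connect_trans; apply; apply: connect1.
by rewrite /del_rel exy xS yS.
Qed.

End Components.

Section InnerDegree.
Variables (T : finType) (e : rel T).

(* Each edge inside [H] is counted twice. *)
Definition inner_deg (H : {set T}) : nat :=
  \sum_(t in H) #|[set u in H | e t u]|.

Local Open Scope ring_scope.

Variables (P : {set {set T}}) (D : {set T}).
Hypothesis partP : partition P D.
Hypothesis closedP : forall H t u, H \in P -> t \in H -> u \in D -> e t u -> u \in H.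
Variable w : {set T} -> rat.

Definition block_fun : T -> rat :=
  fun t => if t \in D then w (pblock P t) else 0.

Let x := block_fun.

Lemma block_funE H t : H \in P -> t \in H -> x t = w H.
Proof.
case/and3P: (partP) => /eqP covP tiP _ HP tH; rewrite /x /block_fun -covP.
have -> : t \in cover P by apply/bigcupP; exists H.
by rewrite (def_pblock tiP HP tH).
Qed.

Lemma sum_block_fun (F : T -> rat) :
  \sum_t x t * F t = \sum_(H in P) w H * \sum_(t in H) F t.
Proof.
transitivity (\sum_(t in D) x t * F t).
  rewrite [RHS]big_mkcond; apply: eq_bigr => t _; rewrite /x /block_fun.
  by case: ifP; rewrite ?mul0r.
rewrite (set_partition_big _ partP); apply: eq_bigr => H HP.
by rewrite big_distrr; apply: eq_bigr => t tH; rewrite (block_funE HP tH).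
Qed.

Lemma dot_block_fun : dot x x = \sum_(H in P) w H ^+ 2 * #|H|%:R.
Proof.
rewrite /dot sum_block_fun; apply: eq_bigr => H HP.
rewrite expr2 -mulrA; congr (_ * _).
rewrite (eq_bigr (fun=> w H)) => [|t]; last exact: block_funE.
by rewrite sumr_const mulr_natr.
Qed.

(** Closedness excludes edges between blocks and the function vanishes off [D], so only ordered
    pairs within one block contribute. *)
Lemma dot_adjop_block_fun :
  dot x (adjop e x) = \sum_(H in P) w H ^+ 2 * (inner_deg H)%:R.
Proof.
rewrite /dot sum_block_fun; apply: eq_bigr => H HP.
rewrite expr2 -mulrA natr_sum !big_distrr; apply: eq_bigr => t tH /=.
congr (_ * _); rewrite /adjop -sum1_card natr_sum big_distrr /=.
rewrite [LHS]big_mkcond [RHS]big_mkcond; apply: eq_bigr => u _; rewrite inE.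
case: (boolP (u \in H)) => [uH|uH].
  by rewrite (block_funE HP uH) mulr1.
case: ifP => //= etu; rewrite /x /block_fun; case: ifP => // uD.
by rewrite (closedP HP tH uD etu) in uH.
Qed.

End InnerDegree.

Section RatioBound.
Local Open Scope ring_scope.
Variables (T : finType) (e : rel T) (d l q : rat).
Hypothesis T_gt0 : (0 < #|T|)%N.
Hypotheses (l_gt0 : 0 < l) (q_gt0 : 0 < q) (dl : d + l = q * l).
Hypothesis hoffman : forall x : T -> rat,
  (d + l) / #|T|%:R * (\sum_t x t) ^+ 2 <= dot x (adjop e x) + l * dot x x.

Variables (P : {set {set T}}) (D : {set T}).
Hypothesis partP : partition P D.
Hypothesis closedP : forall H t u, H \in P -> t \in H -> u \in D -> e t u -> u \in H.

(** The weights [w] make both the sum of the test function and the right side of [hoffman] equal to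
    [Phi], so that a positive [Phi] can be cancelled. By Cauchy-Schwarz they are the optimal
    weights. *)
Lemma ratio_bound :
  q * l * \sum_(H in P) #|H|%:R ^+ 2 / ((inner_deg e H)%:R + l * #|H|%:R)
    <= #|T|%:R.
Proof.
pose w (H : {set T}) : rat := #|H|%:R / ((inner_deg e H)%:R + l * #|H|%:R).
set Phi := \sum_(H in P) _.
have den H : H \in P -> 0 < (inner_deg e H)%:R + l * #|H|%:R.
  move=> HP; rewrite ltr_wpDl ?ler0n // mulr_gt0 // ltr0n card_gt0.
  by apply: contraTneq HP => ->; case/and3P: partP.
have PhiE : Phi = \sum_(H in P) w H * \sum_(t in H) 1.
  apply: eq_bigr => H _; by rewrite sumr_const /w expr2 mulrAC.
have sx : \sum_t block_fun P D w t = Phi.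
  by rewrite PhiE -(sum_block_fun partP w); apply: eq_bigr => t _; rewrite mulr1.
have := hoffman (block_fun P D w); rewrite sx.
rewrite (dot_block_fun partP) (dot_adjop_block_fun partP closedP) big_distrr.
rewrite -big_split /=.
have -> : \sum_(H in P) (w H ^+ 2 * (inner_deg e H)%:R +
                         l * (w H ^+ 2 * #|H|%:R)) = Phi.
  apply: eq_bigr => H HP; rewrite /w.
  by field; rewrite gt_eqF // den.
have Phi_ge0 : 0 <= Phi.
  by apply: sumr_ge0 => H HP; rewrite divr_ge0 ?sqr_ge0 // ltW // den.
move: Phi_ge0; rewrite le0r => /orP [/eqP ->|Phi_gt0]; first by move=> _; rewrite mulr0 ler0n.
rewrite expr2 mulrA ger_pMl // dl mulrAC.
by rewrite ler_pdivrMr ?mul1r // ltr0n.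
Qed.

(** With [d = (q - 1) * l] the excess of a block over [h + q - 1] becomes one fraction with positive
    denominator, so its sign is read off the numerator. *)
Lemma block_slack H : H != set0 ->
  0 < (inner_deg e H)%:R + l * #|H|%:R /\
  q * l * (#|H|%:R ^+ 2 / ((inner_deg e H)%:R + l * #|H|%:R)) - (#|H|%:R + q - 1) =
  ((#|H|%:R - 1) * d * #|H|%:R - (#|H|%:R + q - 1) * (inner_deg e H)%:R)
    / ((inner_deg e H)%:R + l * #|H|%:R).
Proof.
move=> H0; have h_gt0 : 0 < #|H|%:R :> rat by rewrite ltr0n card_gt0.
have den : 0 < (inner_deg e H)%:R + l * #|H|%:R.
  by rewrite ltr_wpDl ?ler0n // mulr_gt0.
split=> //; have -> : d = q * l - l by rewrite -dl addrK.
by field; rewrite gt_eqF.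
Qed.

Lemma sum_block_size :
  \sum_(H in P) (#|H|%:R + q - 1) = #|D|%:R + (q - 1) * #|P|%:R.
Proof.
under eq_bigr do rewrite -addrA.
rewrite big_split sumr_const mulr_natr; congr (_ + _).
by rewrite -natr_sum -(card_partition partP).
Qed.

Lemma toughness_bound :
  (forall H, H \in P ->
    (#|H|%:R + q - 1) * (inner_deg e H)%:R <= (#|H|%:R - 1) * d * #|H|%:R) ->
  #|D|%:R + (q - 1) * #|P|%:R <= #|T|%:R.
Proof.
move=> good; rewrite -sum_block_size; apply: le_trans ratio_bound.
rewrite big_distrr; apply: ler_sum => H HP.
have H0 : H != set0 by apply: contraTneq HP => ->; case/and3P: partP.
have [den eqs] := block_slack H0.
by rewrite -subr_ge0 eqs divr_ge0 ?(ltW den) // subr_ge0 good.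
Qed.

Lemma toughness_bound_strict H :
  (forall H, H \in P ->
    (#|H|%:R + q - 1) * (inner_deg e H)%:R <= (#|H|%:R - 1) * d * #|H|%:R) ->
  H \in P ->
  (#|H|%:R + q - 1) * (inner_deg e H)%:R < (#|H|%:R - 1) * d * #|H|%:R ->
  #|D|%:R + (q - 1) * #|P|%:R < #|T|%:R.
Proof.
move=> good HP sH; rewrite -sum_block_size; apply: lt_le_trans ratio_bound.
have nz H' : H' \in P -> H' != set0.
  by move=> HP'; apply: contraTneq HP' => ->; case/and3P: partP.
rewrite big_distrr (bigD1 H) //= [ltRHS](bigD1 H) //= ltr_leD //.
  have [den eqs] := block_slack (nz H HP).
  by rewrite -subr_gt0 eqs divr_gt0 // subr_gt0.
apply: ler_sum => H' /andP [HP' _].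
have [den eqs] := block_slack (nz H' HP').
by rewrite -subr_ge0 eqs divr_ge0 ?(ltW den) // subr_ge0 good.
Qed.

End RatioBound.

(** * Counting edges inside a vertex set *)

Section InnerDegreeBounds.
Variables (T : finType) (e : rel T).
Hypotheses (e_sym : symmetric e) (e_irr : irreflexive e).
Implicit Types (H Z : {set T}).

Lemma inner_nbhs_proper H t : t \in H -> #|[set u in H | e t u]| <= #|H|.-1.
Proof.
move=> tH; rewrite [#|H|](cardsD1 t) tH /=; apply/subset_leq_card/subsetP => u.
rewrite !inE => /andP [-> etu]; rewrite andbT.
by apply: contraTneq etu => ->; rewrite e_irr.
Qed.

Lemma inner_deg_le H : inner_deg e H <= #|H| * #|H|.-1.
Proof. by rewrite -sum_nat_const; apply: leq_sum => t; apply: inner_nbhs_proper. Qed.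

Lemma inner_nbhs_nonadj H t u : t \in H -> u \in H -> t != u -> ~~ e t u ->
  #|[set w in H | e t w]| < #|H|.-1.
Proof.
move=> tH uH ntu netu.
have -> : #|H|.-1 = #|(H :\ t) :\ u|.+1.
  rewrite [#|H|](cardsD1 t) tH /= [#|H :\ t|](cardsD1 u) !inE uH.
  by rewrite eq_sym ntu.
rewrite ltnS; apply/subset_leq_card/subsetP => w; rewrite !inE => /andP [-> etw].
rewrite andbT; apply/andP; split; apply: contraTneq etw => -> //.
by rewrite e_irr.
Qed.

(** A missing edge costs two ordered pairs, one at [t] and one at [u]. *)
Lemma inner_deg_nonadj H t u : t \in H -> u \in H -> t != u -> ~~ e t u ->
  inner_deg e H + 2 <= #|H| * #|H|.-1.
Proof.
move=> tH uH ntu netu; rewrite -sum_nat_const /inner_deg.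
rewrite (bigD1 t) //= (bigD1 u) ?uH 1?eq_sym //=.
rewrite [leqRHS](bigD1 t) //= [X in _ <= _ + X](bigD1 u) ?uH 1?eq_sym //=.
have lt1 := inner_nbhs_nonadj tH uH ntu netu.
have lt2 : #|[set w in H | e u w]| < #|H|.-1.
  by apply: (inner_nbhs_nonadj uH tH); rewrite 1?eq_sym // e_sym.
have le3 : \sum_(i | (i \in H) && (i != t) && (i != u)) #|[set w in H | e i w]| <=
           \sum_(i | (i \in H) && (i != t) && (i != u)) #|H|.-1.
  by apply: leq_sum => i /andP [/andP [iH _] _]; apply: inner_nbhs_proper.
by move: lt1 lt2 le3; lia.
Qed.

Lemma sum_nbhs_exchange H Z :
  \sum_(t in H) #|[set u in Z | e t u]| = \sum_(u in Z) #|[set t in H | e u t]|.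
Proof.
under eq_bigr do rewrite -sum1dep_card big_mkcondr.
under [RHS]eq_bigr do rewrite -sum1dep_card big_mkcondr.
by rewrite exchange_big; apply: eq_bigr => u _; apply: eq_bigr => t _; rewrite e_sym.
Qed.

(** In a triangle-free graph a neighbour of [v] has no neighbour outside [H] except [v]. Each of the
    [d] neighbours thus sends [d - 1] edges into [H], which are lost from the degree sum
    [d * #|H|]. *)
Lemma inner_deg_compl_closed_nbhd d v H :
  (forall t, #|[set u | e t u]| = d) ->
  (forall a b c, e a b -> e b c -> ~~ e a c) ->
  ~: H = v |: [set u | e v u] ->
  inner_deg e H + d * d.-1 <= d * #|H|.
Proof.
move=> reg tri HE.
have split_nbhs t : #|[set u in H | e t u]| + #|[set u in ~: H | e t u]| = d.
  rewrite -(reg t) -(cardsID H [set u | e t u]); congr (_ + _).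
    by apply: eq_card => u; rewrite !inE andbC.
  by apply: eq_card => u; rewrite !inE.
have : inner_deg e H + \sum_(t in H) #|[set u in ~: H | e t u]| = d * #|H|.
  by rewrite -big_split /= (eq_bigr _ (fun t _ => split_nbhs t)) sum_nat_const mulnC.
rewrite sum_nbhs_exchange => <-; rewrite leq_add2l.
apply: (@leq_trans (\sum_(u in [set u | e v u]) #|[set t in H | e u t]|)).
  rewrite -{1}(reg v) -sum_nat_const; apply: leq_sum => u; rewrite inE => evu.
  rewrite -(reg u) (cardsD1 v) inE e_sym evu /=.
  apply/subset_leq_card/subsetP => t; rewrite !inE => /andP [ntv eut].
  rewrite eut andbT; apply: contraNT (tri _ _ _ evu eut) => tH.
  have : t \in ~: H by rewrite inE.
  by rewrite HE !inE (negPf ntv).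
rewrite HE big_setU1 /= ?inE ?e_irr // leq_addl //.
Qed.

End InnerDegreeBounds.

(** * Binomial estimates and parameters of the Kneser graph *)

Lemma leq_bin a b : 0 < b < a -> a <= 'C(a, b).
Proof.
elim: a b => [|a IHa] [|b] //= ba.
rewrite binS; have [ltba|leab] := ltnP b.+1 a.
  by have := IHa b.+1 ltba; have := bin_gt0 a b; lia.
have -> : a = b.+1 by lia.
by rewrite binn binSn; lia.
Qed.

(** This is [2 * q < d - u] multiplied by [k]. With [m = n - 2 * k] both binomials have lower index
    [m]; Pascal's rule applied twice writes [d - u] as a sum of two binomials with lower index
    [m - 1], which is positive, and each is at least its upper index. *)
Lemma bin_gap n k : 3 <= k -> 2 * k + 2 <= n ->
  2 * n + k * 'C(n - k - 2, k - 2) < k * 'C(n - k, k).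
Proof.
move=> k3 nk; pose m := n - 2 * k.
have -> : 'C(n - k, k) = 'C((m + k - 2).+2, (m - 1).+1).
  by rewrite -bin_sub; [congr ('C(_, _)); lia | lia].
have -> : 'C(n - k - 2, k - 2) = 'C(m + k - 2, (m - 1).+1).
  by rewrite -bin_sub; [congr ('C(_, _)); lia | lia].
have b1 : (m + k - 2).+1 <= 'C((m + k - 2).+1, m - 1) by apply: leq_bin; lia.
have b2 : m + k - 2 <= 'C(m + k - 2, m - 1) by apply: leq_bin; lia.
rewrite binS binS; nia.
Qed.

Lemma kneser_card n k : #|{: kneser_vertex n k}| = 'C(n, k).
Proof.
have := card_kneser_vertex_set k (fun _ : {set 'I_n} => true).
rewrite -cardsT => E; transitivity #|[set A : {set 'I_n} | #|A| == k]|.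
  by rewrite -[RHS]E; apply: eq_card => A; rewrite !inE.
by rewrite card_draws card_ord.
Qed.

Lemma kneser_degree n k (A : kneser_vertex n k) :
  #|[set B | kneser_rel A B]| = 'C(n - k, k).
Proof.
have := @card_between _ set0 (val A) k.
rewrite cards0 card_ord (eqP (valP A)) !subn0 => <- //; last first.
  by rewrite -setI_eq0 set0I.
rewrite (card_kneser_vertex_set k (fun B => [disjoint val A & B])).
by apply: eq_card => B; rewrite !inE sub0set.
Qed.

Lemma kneser_irr n k : 0 < k -> irreflexive (@kneser_rel n k).
Proof.
move=> k0 A; apply/negP; rewrite /kneser_rel -setI_eq0 setIid => /eqP A0.
by have := eqP (valP A); rewrite A0 cards0; lia.
Qed.

Lemma kneser_triangle_free n k (A B C : kneser_vertex n k) :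
  n < 3 * k -> kneser_rel A B -> kneser_rel B C -> ~~ kneser_rel A C.
Proof.
move=> ltn3k; rewrite /kneser_rel -!setI_eq0 => /eqP AB /eqP BC.
apply/negP => /eqP AC.
have := max_card (val A :|: val B :|: val C).
rewrite card_ord !cardsU setIUl AB AC BC setU0 cards0.
by rewrite (eqP (valP A)) (eqP (valP B)) (eqP (valP C)); lia.
Qed.

Lemma dot_cst (T : finType) (x : T -> rat) (a : rat) :
  dot x (fun=> a) = (a * \sum_t x t)%R.
Proof. by rewrite /dot -big_distrl mulrC. Qed.

(** * Eigenvalue bounds for the Kneser graph *)

Section KneserBounds.
Local Open Scope ring_scope.
Variables n k : nat.
Hypotheses (k2 : (2 <= k)%N) (nk : (2 * k + 1 <= n)%N).
Let V := kneser_vertex n k.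
Let d : rat := 'C(n - k, k)%:R.
Let l : rat := 'C(n - k - 1, k - 1)%:R.
Let u : rat := 'C(n - k - 2, k - 2)%:R.
Let N : rat := #|{: V}|%:R.

(** Here [theta 1 = - l] and [theta 2 = u]. By symmetry all the binomials have lower index
    [n - 2 * k], so their size decreases with [i]. *)
Lemma theta_bounds i : (0 < i <= k)%N -> - l <= theta n k i <= u.
Proof.
have binE a b : (a + k = b + (n - k))%N -> (b <= k)%N ->
    'C(a, b) = 'C(a, n - 2 * k).
  by move=> ab bk; rewrite -bin_sub; [congr ('C(_, _)); lia | lia].
case: i => [|[|i]] // ik; rewrite /theta.
  rewrite expr1 mulN1r /l subnAC lexx /=.
  by rewrite (le_trans (_ : _ <= 0)) ?oppr_le0 ?ler0n.
set C : rat := _%:R.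
have Cu : C <= u by rewrite /C /u ler_nat !binE ?leq_bin2l //; lia.
have ul : u <= l.
  by rewrite /u /l ler_nat !binE ?leq_bin2l //; lia.
have C0 : 0 <= C by apply: ler0n.
by rewrite -signr_odd; case: odd; rewrite ?expr0 ?expr1; lra.
Qed.

(** The level bounds are applied to [x] minus its mean. The constant part is an eigenvector for [d],
    orthogonal to the rest, and yields the terms with the squared sum. *)
Lemma kneser_form_bounds (x : V -> rat) :
  - l * (dot x x - (\sum_A x A) ^+ 2 / N) <=
    dot x (adjop (@kneser_rel n k) x) - d * (\sum_A x A) ^+ 2 / N <=
    u * (dot x x - (\sum_A x A) ^+ 2 / N).
Proof.
set s := \sum_A x A.
have N0 : N != 0.
  by rewrite /N kneser_card pnatr_eq0 -lt0n bin_gt0; lia.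
pose m : rat := s / N.
pose y A := x A - m.
have xy A : x A = y A + m * 1 by rewrite mulr1 subrK.
have sy : \sum_A y A = 0.
  by rewrite sumrB sumr_const -mulr_natr -/N /m divfK // subrr.
have K1 A : adjop (@kneser_rel n k) (fun=> m * 1) A = m * d.
  by rewrite /d -(kneser_degree A) cardsE /adjop mulr1 sumr_const mulr_natr.
have [c yc] : exists c : {set 'I_n} -> rat, forall A, y A =
    \sum_(U : {set 'I_n} | (#|U| <= k)%N) c U * incl U A.
  (* Every function has level [k]: for [#|U| = k] the function [incl U] is a point mass. Sets of
     other sizes get coefficient 0. *)
  exists (fun U => if insub U is Some A then y A else 0) => A.
  rewrite (bigD1 (val A)) ?(eqP (valP A)) //= valK /incl subxx mulr1.
  rewrite big1 ?addr0 // => U /andP [leU neU]; case: insubP => [B _ BU|]; last first.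
    by rewrite mul0r.
  suff -> : (U \subset val A) = false by rewrite mulr0.
  apply: contraNF neU => sU; rewrite eqEcard sU (eqP (valP A)) -BU.
  by have := eqP (valP B) => /= ->.
have := kneser_form_bounds_level theta_bounds (leqnn k) yc sy.
clearbody y.
have -> : dot y y = dot x x - s ^+ 2 / N.
  rewrite (dot_eq xy xy) dotDr !dotDl.
  have -> : dot (fun=> m * 1) y = 0 :> rat by rewrite dotC dot_cst sy mulr0.
  have -> : dot y (fun=> m * 1) = 0 :> rat by rewrite dot_cst sy mulr0.
  rewrite dot_cst sumr_const -mulr_natr -/N /m.
  by field.
have -> : dot y (adjop (@kneser_rel n k) y) =
    dot x (adjop (@kneser_rel n k) x) - d * s ^+ 2 / N; last by [].
rewrite (dot_eq xy (adjop_eq _ xy)) (dot_eq (fun=> erefl) (adjopD _ _ _)).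
rewrite dotDr !dotDl.
have -> : dot (fun=> m * 1) (adjop (@kneser_rel n k) y) = 0.
  by rewrite (adjop_sym (@kneser_rel_sym n k)) dotC (dot_eq (fun=> erefl) K1) dot_cst sy mulr0.
have -> : dot y (adjop (@kneser_rel n k) (fun=> m * 1)) = 0.
  by rewrite (dot_eq (fun=> erefl) K1) dot_cst sy mulr0.
rewrite (dot_eq (x := fun=> m * 1) (fun=> erefl) K1) dot_cst sumr_const -mulr_natr -/N /m.
by field.
Qed.

Lemma kneser_hoffman (x : V -> rat) :
  (d + l) / N * (\sum_A x A) ^+ 2 <=
  dot x (adjop (@kneser_rel n k) x) + l * dot x x.
Proof.
have /andP [h _] := kneser_form_bounds x.
rewrite -subr_ge0; rewrite -subr_ge0 in h; apply: le_trans h _.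
by rewrite le_eqVlt; apply/orP; left; apply/eqP; ring.
Qed.

(** The upper form bound at the indicator of [H], an expander mixing estimate. *)
Lemma kneser_inner_deg_le (H : {set V}) :
  N * (inner_deg (@kneser_rel n k) H)%:R <=
  #|H|%:R * (u * (N - #|H|%:R) + d * #|H|%:R).
Proof.
pose x (A : V) : rat := (A \in H)%:R.
have sx : \sum_A x A = #|H|%:R.
  rewrite -sum1_card natr_sum [RHS]big_mkcond.
  by apply: eq_bigr => A _; rewrite /x; case: (A \in H).
have N0 : 0 < N by rewrite /N kneser_card ltr0n bin_gt0; lia.
have xx : dot x x = #|H|%:R.
  rewrite -sx; apply: eq_bigr => A _; rewrite /x.
  by case: (A \in H); rewrite ?mulr1 ?mulr0.
have xKx : dot x (adjop (@kneser_rel n k) x) = (inner_deg (@kneser_rel n k) H)%:R.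
  rewrite natr_sum [RHS]big_mkcond; apply: eq_bigr => A _; rewrite /x.
  case: (A \in H); rewrite ?mul0r ?mul1r //.
  rewrite -sum1dep_card natr_sum /adjop big_mkcond [RHS]big_mkcond.
  by apply: eq_bigr => B _; case: (B \in H); case: kneser_rel.
have /andP [_] := kneser_form_bounds x.
rewrite sx xx xKx -subr_ge0 => h; rewrite -subr_ge0.
rewrite -(pmulr_rge0 _ N0) in h; apply: le_trans h _.
rewrite le_eqVlt; apply/orP; left; apply/eqP; field.
by rewrite gt_eqF.
Qed.

(** The absorption identity gives [k * d = (n - k) * l]. *)
Lemma degree_eigenvalue : d + l = n%:R / k%:R * l.
Proof.
have k0 : k%:R != 0 :> rat by rewrite pnatr_eq0; lia.
have E : (k * 'C(n - k, k) = (n - k) * 'C(n - k - 1, k - 1))%N.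
  have kS : (k - 1).+1 = k by lia.
  by have := mul_bin_diag (n - k) (k - 1); rewrite kS -subn1.
apply: (mulfI k0); rewrite mulrDr /d /l -natrM E natrM natrB; last by lia.
by field.
Qed.

End KneserBounds.

(** * Non-singleton components *)

(** If [h + q - 1 < d], the bound [E <= h * (h - 1)] suffices. Otherwise the bound by [u] reduces
    the claim to [q * d * N < (d - u) * (h + q - 1) * (N - h)]. *)
Lemma block_estimate (h E N d u q : rat) :
  (1 < h -> 0 <= E -> 1 <= q -> 0 < d ->
  E <= h * (h - 1) -> N * E <= h * (u * (N - h) + d * h) ->
  h + d <= N -> 2 * q < d - u ->
  (h + q - 1) * E < (h - 1) * d * h)%R.
Proof.
move=> h1 E0 q1 d0 Eh EN hN du.
have N0 : (0 < N)%R by lra.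
have [small|large] := ltP (h + q - 1)%R d.
  apply: (@le_lt_trans _ _ ((h + q - 1) * (h * (h - 1))))%R.
    by rewrite ler_wpM2l //; lra.
  have -> : ((h - 1) * d * h = d * (h * (h - 1)))%R by ring.
  by rewrite ltr_pM2r // mulr_gt0 //; lra.
(* Both factors [a = h + q - 1] and [b = N - h] are at least [d], so [2 * a * b >= d * (a + b)], and
   [a + b = N + q - 1]. *)
have ab : (d * N <= 2 * ((h + q - 1) * (N - h)))%R.
  have : (0 <= (h + q - 1 - d) * (N - h - d))%R by rewrite mulr_ge0 //; lra.
  have : (0 <= d * (h + q - 1 - d + (N - h - d)))%R by rewrite mulr_ge0 //; lra.
  by have : (0 <= d * (q - 1))%R by [rewrite mulr_ge0 //; lra]; lra.
have key : (q * (d * N) < (d - u) * ((h + q - 1) * (N - h)))%R.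
  have ab0 : (0 < (h + q - 1) * (N - h))%R by rewrite mulr_gt0 //; lra.
  have := ltr_pM2r ab0 (2 * q)%R (d - u)%R; rewrite du.
  have : (q * (d * N) <= q * (2 * ((h + q - 1) * (N - h))))%R.
    by rewrite ler_wpM2l //; lra.
  by lra.
rewrite -(ltr_pM2l N0); apply: (@le_lt_trans _ _
    ((h + q - 1) * (h * (u * (N - h) + d * h)))%R).
  by rewrite mulrCA ler_wpM2l //; lra.
have h0 : (0 < h)%R by lra.
rewrite -subr_gt0.
have -> : (N * ((h - 1) * d * h) - (h + q - 1) * (h * (u * (N - h) + d * h)) =
           h * ((d - u) * ((h + q - 1) * (N - h)) - q * (d * N)))%R by ring.
by rewrite mulr_gt0 // subr_gt0.
Qed.

(** The block inequality times 3 for [K(7,3)]: [N = 35], [d = 4], [u = 2], [q = 7/3]. The last bound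
    on [E] suffices for [h] from 4 to 29: the comparison is a convex quadratic in [h], true at both
    ends. The values 2, 3 and 30 use the other bounds. *)
Lemma block_estimate_7_3 h E : 1 < h -> h <= 30 -> E <= h * h.-1 ->
  (2 < h -> E + 2 <= h * h.-1) -> (h = 30 -> E + 4 * 3 <= 4 * h) ->
  35 * E <= h * (70 + 2 * h) -> (3 * h + 4) * E < 12 * h * h.-1.
Proof.
move=> h1 h30 E1 E2 E3 E4.
have [h2|h3] := leqP h 2; first by move: E1; have -> : h = 2 by [lia]; rewrite muln1; lia.
have [hE|h4] := eqVneq h 3; first by move: (E2 h3); rewrite hE; lia.
have [hE|h29] := eqVneq h 30; first by move: (E3 hE); rewrite hE; lia.
rewrite -(ltn_pmul2l (isT : 0 < 35)).
apply: (@leq_ltn_trans ((3 * h + 4) * (h * (70 + 2 * h)))).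
  by rewrite mulnCA leq_mul2l E4 orbT.
have [m hE] : exists m, h = m + 4 by exists (h - 4); lia.
by rewrite hE /= addnS /=; nia.
Qed.

(** The block inequality times 4 for [K(9,4)]: [N = 126], [d = 5], [u = 3], [q = 9/4]. The last
    bound on [E] suffices for [h] from 5 to 120. *)
Lemma block_estimate_9_4 h E : 1 < h -> h <= 120 -> E <= h * h.-1 ->
  (2 < h -> E + 2 <= h * h.-1) ->
  126 * E <= h * (378 + 2 * h) -> (4 * h + 5) * E < 20 * h * h.-1.
Proof.
move=> h1 h120 E1 E2 E4.
have [h2|h3] := leqP h 2; first by move: E1; have -> : h = 2 by [lia]; rewrite muln1; lia.
have [hE|h3'] := eqVneq h 3; first by move: (E2 h3); rewrite hE; lia.
have [hE|h4] := eqVneq h 4; first by move: (E2 h3); rewrite hE; lia.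
rewrite -(ltn_pmul2l (isT : 0 < 126)).
apply: (@leq_ltn_trans ((4 * h + 5) * (h * (378 + 2 * h)))).
  by rewrite mulnCA leq_mul2l E4 orbT.
have [m hE] : exists m, h = m + 5 by exists (h - 5); lia.
by rewrite hE /= addnS /=; nia.
Qed.

Section KneserToughness.
Variables n k : nat.
Hypotheses (k34 : k = 3 \/ k = 4) (nk : 2 * k + 1 <= n).
Let e := @kneser_rel n k.
Let V := kneser_vertex n k.
Let d : rat := 'C(n - k, k)%:R%R.
Let q : rat := (n%:R / k%:R)%R.

(** The vertex [v] stands for a member of another component: [H] misses its closed neighbourhood,
    whence [h + d < N]. *)
Lemma kneser_block (H : {set V}) v : 1 < #|H| -> v \notin H ->
  (forall w, e v w -> w \notin H) ->
  ((#|H|%:R + q - 1) * (inner_deg e H)%:R < (#|H|%:R - 1) * d * #|H|%:R)%R.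
Proof.
move=> h1 vH nvH.
have k2 : 2 <= k by case: k34; lia.
have e_irr : irreflexive e by apply: kneser_irr; lia.
have e_sym : symmetric e by apply: kneser_rel_sym.
have E1 := inner_deg_le e_irr H.
have EN := kneser_inner_deg_le k2 nk H.
set h := #|H| in h1 E1 EN *; set E := inner_deg e H in E1 EN *.
have subH : v |: [set w | e v w] \subset ~: H.
  by apply/subsetP => w; rewrite !inE => /orP [/eqP ->|/nvH].
have cardN : #|v |: [set w | e v w]| = 'C(n - k, k).+1.
  by rewrite cardsU1 kneser_degree inE e_irr.
have hN : h + 'C(n - k, k) < #|{: V}|.
  by rewrite -(cardsC H) -/h -addnS leq_add2l -cardN subset_leq_card.
have hS : (h.-1%:R = h%:R - 1 :> rat)%R by rewrite -subn1 natrB //; lia.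
have k0 : (k%:R != 0 :> rat)%R by rewrite pnatr_eq0; lia.
have kgt0 : (0 < k%:R :> rat)%R by rewrite ltr0n; lia.
have [nk2|nk2] := leqP (2 * k + 2) n.
  apply: (@block_estimate _ _ #|{: V}|%:R _ 'C(n - k - 2, k - 2)%:R).
  - by rewrite ltr1n.
  - by rewrite ler0n.
  - by rewrite /q ler_pdivlMr // mul1r ler_nat; lia.
  - by rewrite ltr0n bin_gt0; lia.
  - by rewrite -hS -natrM ler_nat.
  - exact: EN.
  - by rewrite -natrD ler_nat ltnW.
  - have k3 : 3 <= k by case: k34; lia.
    have := bin_gap k3 nk2; rewrite -(ltr_nat rat) natrD !natrM => gap.
    by rewrite /q mulrA ltr_pdivrMr // mulrBl; move: gap; rewrite /d; lra.
have nE : n = 2 * k + 1 by lia.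
(* Here [d - u = 2] is too small for [block_estimate].  Triangle-freeness settles
   [h <= k], the bound by [u] larger [h], and for [n = 7] the remaining case
   [h = 30] is the complement of a closed neighbourhood. *)
have tri : forall A B C, e A B -> e B C -> ~~ e A C.
  by move=> A B C; apply: kneser_triangle_free; lia.
(* Of three vertices in a triangle-free graph, two are nonadjacent. *)
have E2 : 2 < h -> E + 2 <= h * h.-1.
  move=> h2; have /card_gt2P [A [B [C [[AH BH CH] [nAB nBC nCA]]]]] := h2.
  have [AB|AB] := boolP (e A B); last exact: inner_deg_nonadj AB.
  have [BC|BC] := boolP (e B C); last exact: inner_deg_nonadj BC.
  by apply: (inner_deg_nonadj e_sym e_irr AH CH); rewrite 1?eq_sym // (tri _ _ _ AB BC).
have Vn : #|{: V}| = 'C(n, k) := kneser_card n k.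
case: k34 => kE.
  have nE' : n = 7 by lia.
  have dE : 'C(n - k, k) = 4 by rewrite nE' kE.
  have VE : #|{: V}| = 35 by rewrite Vn nE' kE.
  have E3 : h = 30 -> E + 4 * 3 <= 4 * h.
    move=> h30.
    apply: (inner_deg_compl_closed_nbhd e_sym e_irr (d := 4) (v := v)) => //.
      by move=> A; rewrite -dE; apply: kneser_degree.
    (* The closed neighbourhood of [v] has 5 = 35 - 30 vertices, so it fills the complement of
       [H]. *)
    apply/esym/eqP; rewrite eqEcard subH cardN dE.
    by rewrite /= -(leq_add2l 30) -{1}h30 cardsC VE.
  have E4 : 35 * E <= h * (70 + 2 * h).
    rewrite -(ler_nat rat) !natrM natrD natrM.
    move: EN; rewrite VE dE nE' kE.
    have -> : 'C(7 - 3 - 2, 3 - 2) = 2 by [].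
    by lra.
  have h30 : h <= 30 by move: hN; rewrite dE VE; lia.
  have := block_estimate_7_3 h1 h30 E1 E2 E3 E4.
  rewrite -(ltr_nat rat) !natrM natrD natrM hS /d dE /q nE' kE.
  by lra.
have nE' : n = 9 by lia.
have dE : 'C(n - k, k) = 5 by rewrite nE' kE.
have VE : #|{: V}| = 126 by rewrite Vn nE' kE.
have E4 : 126 * E <= h * (378 + 2 * h).
  rewrite -(ler_nat rat) !natrM natrD natrM.
  move: EN; rewrite VE dE nE' kE.
  have -> : 'C(9 - 4 - 2, 4 - 2) = 3 by [].
  by lra.
have h120 : h <= 120 by move: hN; rewrite dE VE; lia.
have := block_estimate_9_4 h1 h120 E1 E2 E4.
rewrite -(ltr_nat rat) !natrM natrD natrM hS /d dE /q nE' kE.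
by lra.
Qed.

End KneserToughness.

(** * Vertex cuts and independent sets *)

Lemma comp_of_independent (T : finType) (e : rel T) (J : {set T}) x :
  independent e J -> x \in J -> comp_of e (~: J) x = [set x].
Proof.
move=> indJ xJ; apply/setP => y; rewrite !inE.
apply/connectP/eqP => [[[|z p] //= /andP [/and3P [exz _ zJ] _] _]|->]; last by exists [::].
rewrite !inE negbK in zJ.
by move/forall_inP: indJ => /(_ x xJ) /forall_inP /(_ z zJ); rewrite exz.
Qed.

Lemma ncomp_independent (T : finType) (e : rel T) (J : {set T}) :
  independent e J -> ncomp e (~: J) = #|J|.
Proof.
move=> indJ; rewrite /ncomp setCK card_in_imset // => x y xJ yJ.
by rewrite !comp_of_independent // => /set1_inj.
Qed.

Section KneserCuts.
Variables n k : nat.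
Hypotheses (k34 : k = 3 \/ k = 4) (nk : 2 * k + 1 <= n).
Let e := @kneser_rel n k.
Let V := kneser_vertex n k.
Let q : rat := (n%:R / k%:R)%R.

Let k2 : 2 <= k. Proof. by case: k34; lia. Qed.
Let e_sym : symmetric e. Proof. exact: kneser_rel_sym. Qed.
Let e_irr : irreflexive e. Proof. by apply: kneser_irr; lia. Qed.

Let V_gt0 : 0 < #|{: V}|.
Proof. by rewrite kneser_card bin_gt0; lia. Qed.

Let l_gt0 : (0 < 'C(n - k - 1, k - 1)%:R :> rat)%R.
Proof. by rewrite ltr0n bin_gt0; lia. Qed.

Lemma singleton_block (H : {set V}) : #|H| = 1 -> inner_deg e H = 0.
Proof. by move=> h1; have := inner_deg_le e_irr H; rewrite h1; lia. Qed.

Let cut_bound S := toughness_bound V_gt0 l_gt0 (degree_eigenvalue k2 nk)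
  (kneser_hoffman k2 nk) (comps_partition S e_sym) (@comps_closed _ e S).

Let cut_bound_strict S :=
  toughness_bound_strict V_gt0 l_gt0 (degree_eigenvalue k2 nk)
  (kneser_hoffman k2 nk) (comps_partition S e_sym) (@comps_closed _ e S).

(** Hoffman's ratio bound: delete [~: J], so that all components are singletons, for which the block
    inequality is an equality. *)
Lemma kneser_independent_bound (J : {set V}) :
  independent e J -> (q * #|J|%:R <= #|{: V}|%:R)%R.
Proof.
move=> indJ; have := @cut_bound (~: J); rewrite setCK -/q.
have -> : #|comps e (~: J)| = #|J| by apply: ncomp_independent.
rewrite mulrBl mul1r addrC subrK; apply => H /imsetP [x].
rewrite setCK => xJ ->; rewrite comp_of_independent // cards1.
by rewrite singleton_block ?cards1 // mulr0 subrr !mul0r.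
Qed.

(** A cut leaves a second component, and any vertex of it can serve as [v] in [kneser_block]. *)
Lemma cut_block_lt S H : vertex_cut e S -> H \in comps e S -> 1 < #|H| ->
  ((#|H|%:R + q - 1) * (inner_deg e H)%:R
     < (#|H|%:R - 1) * 'C(n - k, k)%:R * #|H|%:R)%R.
Proof.
move=> cutS HP h1.
have /card_gt1P [H1 [H2 [H1P H2P neH]]] : 1 < #|comps e S| by [].
have [H' H'P neH'] : exists2 H', H' \in comps e S & H' != H.
  by have [E|] := eqVneq H1 H; [exists H2; rewrite // -E eq_sym | exists H1].
have [v] : exists v, v \in H'.
  by case/imsetP: H'P => v _ ->; exists v; apply: mem_comp_of.
move=> vH'.
have HS w : w \in H -> w \notin S.
  case/imsetP: HP => x; rewrite inE => xS ->; exact: comp_of_notin.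
have vH : v \notin H.
  apply: contra neH' => vH; case/imsetP: HP vH => x _ -> vx.
  case/imsetP: H'P vH' => y _ -> vy.
  by rewrite -(comp_of_eq e_sym vx) -(comp_of_eq e_sym vy).
apply: (kneser_block k34 nk h1 vH) => w evw; apply/negP => wH.
have wS : w \in ~: S by rewrite inE HS.
case/negP: vH; apply: (comps_closed HP wH); last by rewrite e_sym.
by case/imsetP: H'P vH' => x; rewrite !inE => xS ->; apply: comp_of_notin.
Qed.

Lemma cut_block_le S H : vertex_cut e S -> H \in comps e S ->
  ((#|H|%:R + q - 1) * (inner_deg e H)%:R
     <= (#|H|%:R - 1) * 'C(n - k, k)%:R * #|H|%:R)%R.
Proof.
move=> cutS HP; have [h1|h1] := ltnP 1 #|H|; first exact/ltW/(cut_block_lt cutS).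
have h0 : 0 < #|H|.
  by rewrite card_gt0; apply: contraTneq HP => ->; case/and3P: (comps_partition S e_sym).
have hE : #|H| = 1 by lia.
by rewrite singleton_block // hE mulr0 subrr !mul0r.
Qed.

Lemma vertices_split (S : {set V}) : (#|{: V}|%:R = #|~: S|%:R + #|S|%:R :> rat)%R.
Proof. by rewrite -natrD addnC cardsC. Qed.

Lemma kneser_cut_le S : vertex_cut e S -> ((q - 1) * (ncomp e S)%:R <= #|S|%:R)%R.
Proof.
move=> cutS; have := cut_bound (fun H => cut_block_le cutS).
by rewrite (vertices_split S) lerD2l.
Qed.

(** A larger component would make the bound strict, so [~: S] is independent. Then the number of
    vertices is [q * #|~: S|], and the ratio bound shows maximality. *)
Lemma kneser_cut_eq S : vertex_cut e S -> ((q - 1) * (ncomp e S)%:R = #|S|%:R)%R ->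
  max_independent e (~: S).
Proof.
move=> cutS eqS.
have h1 H : H \in comps e S -> #|H| <= 1.
  move=> HP; rewrite leqNgt; apply/negP => h.
  have := cut_bound_strict (fun H => cut_block_le cutS) HP (cut_block_lt cutS HP h).
  by rewrite (vertices_split S) ltrD2l -/q -eqS ltxx.
have indS : independent e (~: S).
  apply/forall_inP => x xS; apply/forall_inP => y yS; apply/negP => exy.
  have xP : comp_of e S x \in comps e S by apply: imset_f.
  have /card_le1_eqP/(_ x y (mem_comp_of _ _ _)) := h1 _ xP.
  rewrite (comps_closed xP (mem_comp_of _ _ _) yS exy) => /(_ isT) xy.
  by rewrite xy e_irr in exy.
split=> // J /kneser_independent_bound.
have cE : ncomp e S = #|~: S| by rewrite -(ncomp_independent indS) setCK.
rewrite (vertices_split S) -eqS cE mulrBl mul1r addrC subrK.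
have q0 : (0 < q)%R by rewrite divr_gt0 // ltr0n; lia.
by rewrite ler_pM2l // ler_nat.
Qed.

(** The complement of the star of all [k]-sets through one point; equality holds because
    [k * C(n, k) = n * C(n-1, k-1)]. *)
Lemma kneser_star_cut :
  exists2 S, vertex_cut e S & ((q - 1) * (ncomp e S)%:R = #|S|%:R)%R.
Proof.
have n0 : 0 < n by lia.
pose J : {set V} := [set A : V | Ordinal n0 \in val A].
have indJ : independent e J.
  apply/forall_inP => A; rewrite inE => Ax; apply/forall_inP => B.
  rewrite inE => Bx; apply/pred0Pn; exists (Ordinal n0).
  exact/andP.
have cJ : #|J| = 'C(n - 1, k - 1).
  have := @card_between _ [set Ordinal n0] set0 k.
  rewrite cards0 cards1 card_ord subn0 => <- //; last 2 first.
  - by rewrite -setI_eq0 setI0.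
  - by lia.
  rewrite (card_kneser_vertex_set k (fun A => Ordinal n0 \in A)).
  apply: eq_card => A; rewrite !inE sub1set.
  by have -> : [disjoint set0 & A] by rewrite -setI_eq0 set0I.
exists (~: J).
  rewrite /vertex_cut ncomp_independent // cJ.
  (* There are at least two components, since [C(n-1, k-1) >= n - 1 >= 2]. *)
  by apply: (@leq_trans (n - 1)); [|apply: leq_bin]; lia.
rewrite ncomp_independent //.
have := vertices_split (~: J); rewrite setCK.
suff -> : (#|{: V}|%:R = q * #|J|%:R :> rat)%R by rewrite mulrBl mul1r => ->; ring.
have E : k * 'C(n, k) = n * 'C(n - 1, k - 1).
  have kS : (k - 1).+1 = k by lia.
  by have := mul_bin_diag n (k - 1); rewrite kS -subn1.
have k0 : (k%:R != 0 :> rat)%R by rewrite pnatr_eq0; lia.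
apply: (mulfI k0); rewrite kneser_card cJ -natrM E natrM /q.
by field.
Qed.

End KneserCuts.

Theorem theorem1p2 (n k : nat) :
  (k = 3 \/ k = 4) -> 2 * k + 1 <= n ->
  is_toughness (@kneser_rel n k) (n%:R / k%:R - 1)%R /\
  (forall S : {set kneser_vertex n k},
     vertex_cut (@kneser_rel n k) S ->
     cut_ratio (@kneser_rel n k) S = (n%:R / k%:R - 1)%R ->
     exists I : {set kneser_vertex n k},
       max_independent (@kneser_rel n k) I /\ S = ~: I).
Proof.
move=> k34 nk.
have c_gt0 S : vertex_cut (@kneser_rel n k) S ->
    (0 < (ncomp (@kneser_rel n k) S)%:R :> rat)%R.
  by move=> cutS; rewrite ltr0n ltnW.
split; first split.
- have [S cutS eqS] := kneser_star_cut k34 nk; exists S => //.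
  by rewrite /cut_ratio -eqS mulfK // gt_eqF // c_gt0.
- by move=> S cutS; rewrite ler_pdivlMr ?c_gt0 // kneser_cut_le.
move=> S cutS eqS; exists (~: S); rewrite setCK; split=> //.
by apply: kneser_cut_eq => //; rewrite -eqS divfK // gt_eqF // c_gt0.
Qed.
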